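(* Let $G$ be a finite group and $p$ a prime. Then $\chi_p(G)\equiv 1\pmod p$.
   Context: $\mathscr{C}_p(G)$ is the poset, ordered by inclusion, of all right cosets $Hx$ ($x\in G$) of $p$-subgroups $H$ of $G$ (including the trivial subgroup). For a finite poset $\mathcal{P}$, $\chi(\mathcal{P})=\sum_{i\ge 0}(-1)^i\#\{\text{chains of } i+1 \text{ elements in }\mathcal{P}\}$ is the (non-reduced) Euler characteristic of its order complex. $|G|_{p'}$ is the largest positive divisor of $|G|$ coprime to $p$, and $\chi_p(G):=\chi(\mathscr{C}_p(G))/|G|_{p'}$, which is an integer. *)

(* Defs.v *)
From mathcomp Require Import all_boot all_order all_fingroup all_algebra all_solvable.

Set Implicit Arguments.
Unset Strict Implicit.
Unset Printing Implicit Defensive.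

Import Order.TTheory GRing.Theory.
Import Order.DefaultSetSubsetOrder.

Local Open Scope ring_scope.

Section EulerCharacteristic.

Variables (d : Order.disp_t) (T : finPOrderType d).
Implicit Types C P : {set T}.

Definition is_chain C : bool := [forall x in C, forall y in C, (x >=< y)%O].

Definition chains P (k : nat) : {set {set T}} :=
  [set C : {set T} | [&& C \subset P, is_chain C & #|C| == k]].

(* Nonreduced; the sum stops at #|P| because a chain in P has at most #|P|
   elements. *)
Definition euler_char P : int :=
  \sum_(i < #|P|) (-1) ^+ i * (#|chains P i.+1|)%:Z.

End EulerCharacteristic.

Section CosetPoset.

Variables (gT : finGroupType) (p : nat) (G : {group gT}).

(* Ordered by inclusion: the canonical order on {set gT} from
   Order.DefaultSetSubsetOrder. *)
Definition coset_poset : {set {set gT}} :=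
  (\bigcup_(H : {group gT} | (H \subset G) && p.-group H) rcosets H G)%g.

(* Taken in rat, so that integrality is not built into the definition. *)
Definition chi_p : rat :=
  (euler_char coset_poset)%:~R / (#|G|`_p^')%:R.

End CosetPoset.

(* Main.v *)
Require Import Defs.
From mathcomp Require Import all_boot all_order all_fingroup all_algebra all_solvable.

(** Grouping the nonempty chains of a finite poset P by their least element a
gives chi(P) = sum over a of f(P_{>a}), where f(Q) is the signed count of all
chains of Q, the empty one included ([euler_char_sum_above]).

In the poset of right cosets Hx of p-subgroups, right translation by an element
of G is an automorphism, so f(P_{>Hx}) = f(P_{>H}) is the same for the |G : H|
cosets of H. Hence chi(P) = sum over H of |G : H| f(P_{>H})
([euler_char_coset_poset]). Since H is a p-group,
|G : H| = (|G|_p / |H|) * |G|_{p'}, so dividing by |G|_{p'} yields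

  chi_p(G) = sum over p-subgroups H of (|G|_p / |H|) f(P_{>H}),

an integer. Modulo p only the Sylow subgroups contribute, as |G|_p / |H| is
otherwise a nontrivial power of p ([dvdn_nonSylow_index]). A Sylow subgroup is
maximal in the poset ([above_Sylow]), so its term is f(set0) = 1. What remains
is the number of Sylow p-subgroups, which is 1 modulo p by Sylow's theorem. *)
Set Implicit Arguments.
Unset Strict Implicit.
Unset Printing Implicit Defensive.

Import Order.TTheory GRing.Theory.
Import Order.DefaultSetSubsetOrder.

Local Open Scope ring_scope.

Section ChainSums.
Variables (d : Order.disp_t) (T : finPOrderType d).
Implicit Types (C D P : {set T}) (a b : T) (h : T -> T).

(** This is minus the reduced Euler characteristic: the empty chain counts, and
chains are signed by cardinality rather than by dimension. *)
Definition chain_sum P : int :=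
  \sum_(C : {set T} | (C \subset P) && is_chain C) (-1) ^+ #|C|.

Definition above P a : {set T} := [set b in P | (a < b)%O].

Lemma chainP C :
  reflect {in C &, forall x y, (x >=< y)%O} (is_chain C).
Proof.
apply: (iffP forall_inP) => [Cc x y Cx Cy | Cc x Cx].
  exact: (forall_inP (Cc x Cx)).
by apply/forall_inP => y; apply: Cc.
Qed.

Lemma chain_sum_set0 : chain_sum set0 = 1.
Proof.
rewrite /chain_sum (big_pred1 set0) ?cards0 // => C; rewrite subset0.
by apply/andb_idr => /eqP->; apply/chainP => x y; rewrite inE.
Qed.

Lemma chain_sum_imset h P :
  {mono h : x y / (x <= y)%O} -> chain_sum (h @: P) = chain_sum P.
Proof.
move=> h_mono; have h_inj : injective h := inc_inj h_mono.
rewrite /chain_sum (reindex_inj (imset_inj h_inj)) /=.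
apply: eq_big => [C | C _]; last by rewrite card_imset.
congr andb.
  apply/idP/idP => [hCP | CP]; last exact: imsetS.
  by apply/subsetP => x /(imset_f h)/(subsetP hCP); rewrite mem_imset.
apply/chainP/chainP => [hC x y Cx Cy | hC _ _ /imsetP[x Cx ->] /imsetP[y Cy ->]].
  by have := hC _ _ (imset_f h Cx) (imset_f h Cy); rewrite /Order.comparable !h_mono.
by rewrite /Order.comparable !h_mono; apply: hC.
Qed.

Lemma above_imset h P a :
  {mono h : x y / (x <= y)%O} -> above (h @: P) (h a) = h @: above P a.
Proof.
move=> h_mono; have h_lt := leW_mono h_mono.
apply/setP=> y; rewrite inE; apply/andP/imsetP => [[/imsetP[x Px ->]] | [x]].
  by rewrite h_lt => ax; exists x; rewrite // inE Px.
by rewrite inE => /andP[Px ax] ->; rewrite imset_f // h_lt.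
Qed.

Lemma chain_has_least C :
    is_chain C -> C != set0 ->
  exists2 a, a \in C & {in C, forall b, (a <= b)%O}.
Proof.
move=> /chainP Cc /set0Pn[c Cc0].
by case: (Order.POrderTheory.comparable_arg_minP (F := id) Cc0) => [x y|a]; [apply: Cc | exists a].
Qed.

Lemma euler_char_sum_chains P :
  euler_char P = \sum_(C : {set T} | [&& C \subset P, is_chain C & C != set0])
                   - (-1) ^+ #|C|.
Proof.
transitivity (\sum_(i < #|P|) \sum_(C in chains P i.+1) - (-1) ^+ #|C| : int).
  apply: eq_bigr => i _; rewrite (eq_bigr (fun=> (-1) ^+ i)) => [|C].
    by rewrite sumr_const -mulr_natr natz.
  by rewrite inE => /and3P[_ _ /eqP->]; rewrite exprS mulN1r opprK.
rewrite (exchange_big_dep (fun C : {set T} => [&& C \subset P, is_chain C & C != set0])) /=.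
  apply: eq_bigr => C /and3P[CP Cc]; rewrite -card_gt0 => C_gt0.
  have C_lt : (#|C|.-1 < #|P|)%N by rewrite prednK // subset_leq_card.
  (* A chain is counted at the single index i with i.+1 = #|C|. *)
  rewrite (big_pred1 (Ordinal C_lt)) // => i.
  by rewrite /= inE CP Cc -val_eqE /= -{1}(prednK C_gt0) eqSS eq_sym.
by move=> i C _; rewrite inE -card_gt0 => /and3P[-> -> /eqP->].
Qed.

(** Removing the least element a from a nonempty chain C of P is a bijection
onto the chains of P_{>a}, with D |-> a |: D as inverse. It lowers the
cardinality by one, which absorbs the sign in front of the sum over C. *)
Lemma euler_char_sum_above P :
  euler_char P = \sum_(a in P) chain_sum (above P a).
Proof.
pose least C a := (a \in C) && [forall b in C, (a <= b)%O].
rewrite euler_char_sum_chains.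
(* The inner sum has exactly one term, so that exchanging the two sums groups
   the chains by their least element. *)
transitivity (\sum_(C : {set T} | [&& C \subset P, is_chain C & C != set0])
                 \sum_(a in P | least C a) - (-1) ^+ #|C| : int).
  apply: eq_bigr => C /and3P[CP Cc C0].
  have [a Ca a_le] := chain_has_least Cc C0.
  rewrite (big_pred1 a) // => b.
  apply/andP/eqP => [[_ /andP[Cb /forall_inP b_le]] | ->]; last first.
    by rewrite (subsetP CP) // /least Ca; split=> //; apply/forall_inP.
  by apply/eqP; rewrite eq_le b_le // a_le.
rewrite (exchange_big_dep (mem P)) /=; last by move=> C a _ /andP[].
apply: eq_bigr => a Pa.
rewrite (reindex_onto (fun D => a |: D) (fun C => C :\ a)); last first.
  by move=> C /and3P[_ _ /andP[Ca _]]; exact: setD1K.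
apply: eq_big => [D | D /andP[_ /eqP aD]]; last first.
  have aND : a \notin D by rewrite -aD !inE eqxx.
  by rewrite cardsU1 aND exprS mulN1r opprK.
apply/idP/idP.
  case/andP=> /andP[/and3P[aDP /chainP aDc _] /and3P[_ _ /forall_inP a_le]] /eqP aD.
  apply/andP; split.
    apply/subsetP => b Db; rewrite inE (subsetP aDP) ?setU1r //=.
    rewrite lt_neqAle a_le ?setU1r // andbT.
    by apply: contraTneq Db => <-; rewrite -aD !inE eqxx.
  by apply/chainP => x y Dx Dy; apply: aDc; apply: setU1r.
case/andP=> /subsetP DP /chainP Dc.
have aD b : b \in D -> (a < b)%O by move/DP; rewrite inE => /andP[].
have aND : a \notin D by apply/negP => /aD; rewrite ltxx.
have a_le b : b \in a |: D -> (a <= b)%O.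
  by case/setU1P => [-> | /aD/ltW].
rewrite setU1K // eqxx andbT /least setU11 Pa /=.
apply/andP; split; last exact/forall_inP.
apply/and3P; split.
- by apply/subsetP => b /setU1P[-> // | /DP]; rewrite inE => /andP[].
- apply/chainP => x y /setU1P[-> | Dx] aDy; first exact/le_comparable/a_le.
  case/setU1P: aDy => [-> | Dy]; last exact: Dc.
  by apply/ge_comparable/a_le/setU1r.
- by apply/set0Pn; exists a; rewrite setU11.
Qed.

End ChainSums.

Section CosetPosetSums.
Variables (gT : finGroupType) (p : nat) (G : {group gT}).
Implicit Types (H : {group gT}) (A : {set gT}).
Local Notation psub H := ((H \subset G) && (p.-group H)%g).

Lemma coset_posetP A :
  reflect (exists H : {group gT}, exists2 x, x \in G & psub H /\ A = (H :* x)%g)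
          (A \in coset_poset p G).
Proof.
apply: (iffP bigcupP) => [[H pH /rcosetsP[x Gx ->]] | [H [x Gx [pH ->]]]].
  by exists H, x.
by exists H => //; apply/rcosetsP; exists x.
Qed.

(** A right coset determines its subgroup, so the families [rcosets H G] do not
overlap; the sum over the poset can thus be split along H. *)
Lemma rcoset_mulV H x : ((H :* x) * (H :* x)^-1)%g = H.
Proof.
by rewrite invMg invg_set1 invGid -mulgA (mulgA [set x]) mulg_set1 mulgV mul1g mulGid.
Qed.

Lemma sum_coset_poset (F : {set gT} -> int) :
  \sum_(A in coset_poset p G) F A
    = \sum_(H : {group gT} | psub H) \sum_(A in rcosets H G) F A.
Proof.
rewrite (partition_big (fun A => <<A * A^-1>>%G) (fun H => psub H)) /=; last first.
  move=> _ /coset_posetP[H [x _ [pH ->]]].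
  by rewrite rcoset_mulV genGid.
apply: eq_bigr => H pH; apply: eq_bigl => A.
apply/andP/rcosetsP => [[/coset_posetP[K [x Gx [_ ->]]]] | [x Gx ->]].
  by rewrite -val_eqE /= rcoset_mulV genGid => /eqP->; exists x.
split; first by apply/coset_posetP; exists H, x.
by rewrite -val_eqE /= rcoset_mulV genGid.
Qed.

Lemma rcoset_mono (x : gT) :
  {mono (fun A => A :* x)%g : A B / (A <= B)%O}.
Proof.
move=> A B; apply/idP/idP => [sAxBx | sAB]; last exact: mulSg.
by have := mulSg [set x^-1%g] sAxBx; rewrite -!rcosetM mulgV !rcoset1.
Qed.

Lemma coset_poset_rcoset x :
  x \in G -> [set (A :* x)%g | A in coset_poset p G] = coset_poset p G.
Proof.
move=> Gx; apply/setP => B; apply/imsetP/coset_posetP.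
  case=> _ /coset_posetP[H [y Gy [pH ->]]] ->.
  by exists H, (y * x)%g; rewrite ?groupM // rcosetM.
case=> H [y Gy [pH ->]]; exists (H :* (y * x^-1))%g; last by rewrite -rcosetM mulgKV.
by apply/coset_posetP; exists H, (y * x^-1)%g; rewrite // groupM ?groupV.
Qed.

(** Translation by x maps the part of the poset above H onto the part above Hx,
so all cosets of H contribute equally. *)
Lemma euler_char_coset_poset :
  euler_char (coset_poset p G)
    = \sum_(H : {group gT} | psub H)
        #|G : H|%g%:Z * chain_sum (above (coset_poset p G) H).
Proof.
rewrite euler_char_sum_above sum_coset_poset; apply: eq_bigr => H _.
rewrite (eq_bigr (fun=> chain_sum (above (coset_poset p G) H))) => [|A].
  by rewrite sumr_const -mulr_natl natz.
case/rcosetsP=> x Gx ->; rewrite -{1}(coset_poset_rcoset Gx).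
by rewrite (above_imset _ _ (@rcoset_mono x)) (chain_sum_imset _ (@rcoset_mono x)).
Qed.

(** A coset Kx containing H contains 1, hence is K itself: any strictly larger
element of the poset would be a p-subgroup strictly containing a Sylow. *)
Lemma above_Sylow H : p.-Sylow(G)%g H -> above (coset_poset p G) H = set0.
Proof.
move=> sylH; apply/eqP/set0Pn => -[B]; rewrite inE => /andP[/coset_posetP].
case=> K [x Gx [/andP[sKG pK] ->]] HltKx.
have sHKx : H \subset (K :* x)%g := ltW HltKx.
have /rcoset_eqP Kx : 1%g \in (K :* x)%g by apply: (subsetP sHKx).
move: HltKx sHKx; rewrite -Kx rcoset1 => HltK sHK.
by rewrite (sub_pHall sylH pK sHK sKG) ltxx in HltK.
Qed.

Lemma index_psubgroup H :
  psub H -> (#|G : H|%g = #|G|`_p %/ #|H| * #|G|`_p^')%N.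
Proof.
case/andP=> sHG pH; rewrite -divgS // -{1}(partnC p (cardG_gt0 G)).
rewrite -divn_mulAC // -{1}(part_pnat_id pH).
by apply: partn_dvd; rewrite ?cardG_gt0 ?cardSg.
Qed.

Lemma dvdn_nonSylow_index H :
  prime p -> psub H -> ~~ p.-Sylow(G)%g H -> (p %| #|G|`_p %/ #|H|)%N.
Proof.
move=> p_pr /andP[sHG pH]; rewrite pHallE sHG /= => HneP.
have dvHP : (#|H| %| #|G|`_p)%N.
  by rewrite -{1}(part_pnat_id pH) partn_dvd ?cardG_gt0 ?cardSg.
have pPH : p.-nat (#|G|`_p %/ #|H|)%N := pnat_div dvHP (part_pnat p _).
case/p_natP: pPH => -[|k] Ek; last by rewrite Ek dvdn_exp.
by rewrite -(divnK dvHP) Ek mul1n eqxx in HneP.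
Qed.

End CosetPosetSums.

Theorem corollary1 (gT : finGroupType) (G : {group gT}) (p : nat)
    (p_pr : prime p) :
  exists z : int, chi_p p G = (z%:~R)%R /\ (z = 1 %[mod p])%Z.
Proof.
pose c (H : {group gT}) := chain_sum (above (coset_poset p G) H).
exists (\sum_(H : {group gT} | (H \subset G) && (p.-group H)%g)
          (#|G|`_p %/ #|H|)%N%:Z * c H).
split.
  rewrite /chi_p euler_char_coset_poset.
  under eq_bigr => H pH do rewrite (index_psubgroup pH) mulnC PoszM -mulrA.
  rewrite -mulr_sumr intrM pmulrn mulrC mulKf //.
  by rewrite intr_eq0 eqz_nat -lt0n part_gt0.
apply/eqP; rewrite (bigID (fun H : {group gT} => p.-Sylow(G)%g H)) /=.
have ->: (\sum_(H : {group gT} | (H \subset G) && (p.-group H)%g && p.-Sylow(G)%g H)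
          (#|G|`_p %/ #|H|)%N%:Z * c H) = #|'Syl_p(G)%g|%:Z.
  rewrite (eq_bigl (mem 'Syl_p(G)%g)) => [|H]; last first.
    rewrite !inE; apply/andb_idl => sylH.
    by rewrite (pHall_sub sylH) (pHall_pgroup sylH).
  rewrite (eq_bigr (fun=> 1)) ?sumr_const ?natz // => H; rewrite !inE => sylH.
  by rewrite /c above_Sylow // chain_sum_set0 (card_Hall sylH) divnn part_gt0.
rewrite eqz_mod_dvd addrAC rpredD //.
  by rewrite -eqz_mod_dvd !modz_nat card_Syl_mod // modn_small ?prime_gt1.
apply: rpred_sum => H /andP[pH nsylH].
by apply: dvdz_mulr; apply: dvdn_nonSylow_index.
Qed.
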